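(* Let $\ell$ be a positive integer with $\ell<4$. Then there exists no graph $G$ with an edge $e\in E(G)$ such that $\gamma_g'(G)=\ell$ and $\gamma_g'(G-e)=\ell+2$.
   Context: Graphs are finite, simple and undirected. A vertex dominates itself and all its neighbors. The domination game on a graph $G$ is played by two players, Dominator and Staller, who alternately choose a vertex of $G$ such that each chosen vertex dominates at least one vertex that was not dominated by the previously chosen vertices. The game ends when all vertices of $G$ are dominated. Dominator wants the total number of chosen vertices to be as small as possible, Staller wants it to be as large as possible. Assuming both play optimally, $\gamma_g'(G)$ (the Staller-start game domination number) is the total number of vertices chosen when Staller moves first. $G-e$ denotes the graph obtained from $G$ by removing the edge $e$ (keeping all vertices). *)

(* Defs.v *)
From mathcomp Require Import all_boot.

Set Implicit Arguments.
Unset Strict Implicit.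
Unset Printing Implicit Defensive.

(* A finite simple graph is a symmetric irreflexive relation on a finType. *)

Definition simple_graph (T : finType) (adj : rel T) : Prop :=
  symmetric adj /\ irreflexive adj.

Definition remove_edge (T : finType) (adj : rel T) (x y : T) : rel T :=
  fun u v => adj u v && ([set u; v] != [set x; y]).

Section DominationGame.

Variables (T : finType) (adj : rel T).
Implicit Types (v : T) (S : {set T}) (n : nat) (staller : bool).

Definition closed_nbhd v : {set T} := [set u | (u == v) || adj v u].

Definition dominated S : {set T} := \bigcup_(v in S) closed_nbhd v.

Definition legal_moves S : {set T} :=
  [set v | ~~ (closed_nbhd v \subset dominated S)].

(* Number of vertices still to be chosen, under optimal play, once the vertices
   of S have been chosen; staller tells whether Staller is next to move.  The
   recursion is bounded by n; by game_lengthE, the bound is irrelevant as soon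
   as it reaches the number of undominated vertices.  Since game_length n never
   exceeds n (game_length_le), the default value n of the minimum plays no role
   when there is a legal move. *)
Fixpoint game_length n staller S : nat :=
  if n is n'.+1 then
    if dominated S == setT then 0
    else if staller then
      (\max_(v in legal_moves S) game_length n' false (v |: S)).+1
    else
      (\big[minn/n']_(v in legal_moves S) game_length n' true (v |: S)).+1
  else 0.

(* Each move dominates a new vertex, so #|T| bounds the length of the game. *)
Definition gamma_g' : nat := game_length #|T| true set0.

Lemma game_length_le n staller S : game_length n staller S <= n.
Proof.
elim: n staller S => [|n IH] staller S //=.
case: ifP => // _; case: staller; rewrite ltnS.
  by apply/bigmax_leqP => v _; apply: IH.
by apply: (big_ind (fun k => k <= n)) => // a b ha hb; rewrite geq_min ha.
Qed.

Lemma dominatedU v S : dominated (v |: S) = closed_nbhd v :|: dominated S.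
Proof. by rewrite /dominated bigcup_setU big_set1. Qed.

Lemma card_undominated v S : v \in legal_moves S ->
  #|~: dominated (v |: S)| < #|~: dominated S|.
Proof.
rewrite inE => hv; apply: proper_card; rewrite properEneq dominatedU.
rewrite setCS subsetUr andbT; apply: contra hv => /eqP/setC_inj <-.
exact: subsetUl.
Qed.

Lemma legal_moves_eq0 S : (legal_moves S == set0) = (dominated S == setT).
Proof.
apply/eqP/eqP => [h|h].
  apply/setP => v; rewrite inE; apply/idP; apply: contraT => hv.
  suff: v \in legal_moves S by rewrite h inE.
  rewrite inE; apply: contra hv => /subsetP; apply.
  by rewrite inE eqxx.
by apply/setP => v; rewrite !inE h subsetT.
Qed.

Lemma game_lengthE n m staller S :
  #|~: dominated S| <= n -> #|~: dominated S| <= m ->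
  game_length n staller S = game_length m staller S.
Proof.
elim: n m staller S => [|n IH] [|m] staller S //=.
- rewrite leqn0 cards_eq0 => /eqP h _.
  by rewrite -[dominated S]setCK h setC0 eqxx.
- move=> _; rewrite leqn0 cards_eq0 => /eqP h.
  by rewrite -[dominated S]setCK h setC0 eqxx.
move=> hn hm; case: ifP => // hD.
have E b v : v \in legal_moves S ->
    game_length n b (v |: S) = game_length m b (v |: S).
  by move=> /card_undominated hv; apply: IH; rewrite -ltnS;
     apply: leq_trans hv _.
have [v0 hv0] : exists v0, v0 \in legal_moves S.
  by apply/set0Pn; rewrite legal_moves_eq0 hD.
have min_le k p (F : T -> nat) : (forall v, v \in legal_moves S -> F v <= p) ->
    \big[minn/k]_(v in legal_moves S) F v
      <= \big[minn/p]_(v in legal_moves S) F v.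
  move=> hp; have le v : v \in legal_moves S ->
      \big[minn/k]_(v in legal_moves S) F v <= F v.
    move=> hv; have: v \in index_enum T by apply: mem_index_enum.
    elim: (index_enum T) => // w s IHs; rewrite inE big_cons.
    case/predU1P => [<-|/IHs hs]; first by rewrite hv geq_minl.
    by case: ifP => // _; rewrite geq_min hs orbT.
  apply: (big_ind (fun x => _ <= x)) => [|a b ha hb|v hv].
  - exact: leq_trans (le _ hv0) (hp _ hv0).
  - by rewrite leq_min ha hb.
  - exact: le.
congr (if _ then _ else _).
  by congr _.+1; apply: eq_bigr => v; apply: E.
congr _.+1.
transitivity (\big[minn/n]_(v in legal_moves S) game_length m true (v |: S)).
  by apply: eq_bigr => v; apply: E.
apply/eqP; rewrite eqn_leq !min_le // => v hv; first by rewrite -E // game_length_le.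
exact: game_length_le.
Qed.

End DominationGame.

(* Main.v *)
Require Import Defs.
From mathcomp Require Import all_boot.

(** Deleting the edge [xy] leaves at most one vertex that was dominated and no
    longer is: such a vertex is one end of the edge, and the other end has been
    chosen.  Dominator copies in [G - e] his replies in [G] as long as they are
    legal there.  With at most three moves in [G] this costs at most one extra
    move.  The only delicate position is the one before the last move of Staller
    in [G]: the set [U] of undominated vertices is then such that every vertex
    dominating one vertex of [U] dominates all of [U], so that if Staller spends
    her move in [G - e] on the lost vertex, Dominator finishes by playing any
    vertex of [U]. *)

(** * Optimal values of positions in an arbitrary graph *)

Section GameValue.

#[local] Set Implicit Arguments.
#[local] Unset Strict Implicit.

Variables (T : finType) (adj : rel T).
Implicit Types (v : T) (S : {set T}) (b : bool) (k n : nat).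

Definition game_value b S : nat := game_length adj #|T| b S.

Lemma game_value_eq0 b S : dominated adj S = setT -> game_value b S = 0.
Proof. by rewrite /game_value => hS; case: #|T| => //= n; rewrite hS eqxx. Qed.

Lemma game_length_leq0 n b S :
  #|~: dominated adj S| <= n -> game_length adj n b S <= 0 ->
  dominated adj S = setT.
Proof.
case: n => [|n] /=.
  by rewrite leqn0 cards_eq0 => /eqP h _; rewrite -[LHS]setCK h setC0.
by case: eqP => // _; case: b.
Qed.

Lemma game_value_leq0 b S : game_value b S <= 0 -> dominated adj S = setT.
Proof. by apply: game_length_leq0; apply: max_card. Qed.

Lemma exists_legal_move S :
  dominated adj S != setT -> exists v, v \in legal_moves adj S.
Proof. by move=> hS; apply/set0Pn; rewrite legal_moves_eq0. Qed.

(** Losing one unit of the bound is harmless: a legal move leaves fewer than [#|T|] vertices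
    undominated. *)
Lemma game_length_move n b S v : #|T| = n.+1 -> v \in legal_moves adj S ->
  game_length adj n b (v |: S) = game_value b (v |: S).
Proof.
move=> hT /card_undominated hv; apply: game_lengthE; last exact: max_card.
by rewrite -ltnS -hT (leq_trans hv) // max_card.
Qed.

Lemma staller_value_leP k S : dominated adj S != setT ->
  (game_value true S <= k.+1) <->
  (forall v, v \in legal_moves adj S -> game_value false (v |: S) <= k).
Proof.
move=> hS; have [v0 _] := exists_legal_move hS.
case hT: #|T| => [|n]; first by have := card0_eq hT v0.
rewrite {1}/game_value hT /= (negPf hS) ltnS.
split=> [/bigmax_leqP h v hv | h].
  by rewrite -(game_length_move _ hT hv); apply: h.
by apply/bigmax_leqP => v hv; rewrite (game_length_move _ hT hv); apply: h.
Qed.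

Lemma bigminn_leP (A : {set T}) (F : T -> nat) m k :
  \big[minn/m]_(v in A) F v <= k <->
  m <= k \/ exists2 v, v \in A & F v <= k.
Proof.
split.
  apply: (big_ind (fun i => i <= k -> _)) => [|i j hi hj|v hv hF]; first by left.
    by rewrite geq_min => /orP[/hi|/hj].
  by right; exists v.
(* The boolean form over the list [index_enum T] lends itself to induction on that list. *)
have le_min i : i <= k \/ (exists2 v, v \in A & F v <= k) ->
    (i <= k) || has [pred v | (v \in A) && (F v <= k)] (index_enum T).
  case=> [-> //|[v hv hF]]; apply/orP; right; apply/hasP.
  by exists v; [apply: mem_index_enum | rewrite /= hv].
move/le_min; elim: (index_enum T) => [|v s IH]; first by rewrite big_nil orbF.
rewrite /= big_cons; case: (v \in A) => //=.
by rewrite geq_min orbCA => /orP[-> //|/IH ->]; rewrite orbT.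
Qed.

Lemma dominator_value_leP k S : dominated adj S != setT ->
  (game_value false S <= k.+1) <->
  (exists2 v, v \in legal_moves adj S & game_value true (v |: S) <= k).
Proof.
move=> hS; have [v0 hv0] := exists_legal_move hS.
case hT: #|T| => [|n]; first by have := card0_eq hT v0.
rewrite {1}/game_value hT /= (negPf hS) ltnS; apply: (iff_trans (bigminn_leP _ _ _ _)).
split=> [[hn | [v hv hF]] | [v hv hF]].
(* If only the default [n] of the minimum is known to be small, any legal move will do, since no
   value exceeds [n]. *)
- exists v0 => //; rewrite -(game_length_move _ hT hv0).
  exact: leq_trans (game_length_le _ _ _ _) hn.
- by exists v => //; rewrite -(game_length_move _ hT hv).
- by right; exists v => //; rewrite (game_length_move _ hT hv).
Qed.

Lemma game_value_le_card b S : game_value b S <= #|~: dominated adj S|.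
Proof.
rewrite /game_value (game_lengthE b (max_card _) (leqnn _)).
exact: game_length_le.
Qed.

Lemma dominated_mem S v : v \in S -> v \in dominated adj S.
Proof. by move=> hv; apply/bigcupP; exists v; rewrite // inE eqxx. Qed.

Lemma undominated_legal S v : v \notin dominated adj S -> v \in legal_moves adj S.
Proof.
by rewrite inE; apply: contra => /subsetP; apply; rewrite inE eqxx.
Qed.

Lemma legal_of_superset S v :
  dominated adj S != setT -> dominated adj (v |: S) = setT ->
  v \in legal_moves adj S.
Proof.
by rewrite dominatedU inE => hS hv; apply: contra hS => /setUidPr <-; apply/eqP.
Qed.

Lemma illegal_dominatedU S v :
  v \notin legal_moves adj S -> dominated adj (v |: S) = dominated adj S.
Proof. by rewrite inE negbK dominatedU => /setUidPr. Qed.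

Lemma dominator_value_le1 S v :
  dominated adj (v |: S) = setT -> game_value false S <= 1.
Proof.
have [hS _|hS hv] := eqVneq (dominated adj S) setT.
  by rewrite game_value_eq0.
apply/(dominator_value_leP _ hS); exists v; first exact: legal_of_superset.
by rewrite game_value_eq0.
Qed.

Lemma staller_value_le k S :
  (forall v, v \in legal_moves adj S -> game_value false (v |: S) <= k) ->
  game_value true S <= k.+1.
Proof.
have [hS _|hS] := eqVneq (dominated adj S) setT; first by rewrite game_value_eq0.
by move/(staller_value_leP _ hS).
Qed.

Lemma dominator_value_le k S v : v \in legal_moves adj S ->
  game_value true (v |: S) <= k -> game_value false S <= k.+1.
Proof.
have [hS _ _|hS hv hk] := eqVneq (dominated adj S) setT.
  by rewrite game_value_eq0.
by apply/(dominator_value_leP _ hS); exists v.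
Qed.

Lemma staller_value_le1 S v : game_value true S <= 1 ->
  v \in legal_moves adj S -> dominated adj (v |: S) = setT.
Proof.
move=> h1 hv; have hS : dominated adj S != setT.
  by rewrite -legal_moves_eq0; apply/set0Pn; exists v.
by move/(staller_value_leP _ hS): h1 => /(_ v hv); apply: game_value_leq0.
Qed.

End GameValue.

(** * Comparison of the games on [G] and [G - e] *)

Section EdgeRemoval.

#[local] Set Implicit Arguments.
#[local] Unset Strict Implicit.

Variables (T : finType) (adj : rel T) (x y : T).
Implicit Types (u v w : T) (S : {set T}) (b : bool).

Let adj' := remove_edge adj x y.
Let lost S := dominated adj S :\: dominated adj' S.

Lemma closed_nbhd_remove_edge v : closed_nbhd adj' v \subset closed_nbhd adj v.
Proof.
apply/subsetP => w; rewrite !inE => /orP[-> //|/andP[-> _]].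
by rewrite orbT.
Qed.

Lemma closed_nbhd_lost v w : w \in closed_nbhd adj v ->
  w \notin closed_nbhd adj' v -> [set v; w] = [set x; y].
Proof.
rewrite !inE /adj' /remove_edge; case: (w == v) => //= ->.
by rewrite negbK => /eqP.
Qed.

Lemma lostP S w : w \in lost S -> exists2 v, v \in S & [set v; w] = [set x; y].
Proof.
case/setDP => /bigcupP[v hv hw] hn; exists v => //; apply: closed_nbhd_lost hw _.
by apply: contra hn => hw; apply/bigcupP; exists v.
Qed.

(** The two ends of the edge cannot both be lost: the partner of a lost end lies in [S], so it still
    dominates itself after the deletion. *)
Lemma card_lost S : #|lost S| <= 1.
Proof.
apply/card_le1_eqP => w w' hw hw'; have [v hv e] := lostP hw.
have [v' hv' e'] := lostP hw'; apply/eqP; rewrite eq_sym.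
have: w \in [set v'; w'] by rewrite e' -e !inE eqxx orbT.
rewrite !inE => /orP[/eqP ew|//].
by case/setDP: hw => _; rewrite ew dominated_mem.
Qed.

Lemma undominated_remove_edge S :
  ~: dominated adj' S \subset lost S :|: ~: dominated adj S.
Proof. by apply/subsetP => w; rewrite !inE => ->; rewrite orbN. Qed.

Lemma card_undominated_remove_edge S :
  dominated adj S = setT -> #|~: dominated adj' S| <= 1.
Proof.
move=> hS; apply: leq_trans (card_lost S); apply: subset_leq_card.
by apply: subset_trans (undominated_remove_edge S) _; rewrite hS setCT setU0.
Qed.

Lemma game_value_remove_edge_dominated b S :
  dominated adj S = setT -> game_value adj' b S <= 1.
Proof.
move=> hS; apply: leq_trans (game_value_le_card _ _ _) _.
exact: card_undominated_remove_edge.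
Qed.

Lemma staller_value_remove_edge S :
  game_value adj true S <= 1 -> game_value adj' true S <= 2.
Proof.
move=> h1; apply: staller_value_le => s hs'.
(* If [s] is legal in [G], it ends the game there, and at most one vertex is left in [G - e]. *)
have [hs|hs] := boolP (s \in legal_moves adj S).
  by apply: game_value_remove_edge_dominated; apply: staller_value_le1.
have [hS|hS] := eqVneq (dominated adj (s |: S)) setT.
  exact: game_value_remove_edge_dominated.
have [u] := exists_legal_move hS.
have {hS}: exists u, u \notin dominated adj S.
  rewrite illegal_dominatedU // in hS.
  by move: hS; rewrite -subTset => /subsetPn[w _ hw]; exists w.
case=> {}u hu _; apply: (@dominator_value_le1 _ _ _ u).
have hUu := staller_value_le1 h1 (undominated_legal hu).
(* Being illegal in [G], [s] can gain only a lost vertex [a] in [G - e]. No other vertex is lost, so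
   [u] has to cover just the vertices undominated in [G]. *)
have /subsetPn[a ha' haS'] : ~~ (closed_nbhd adj' s \subset dominated adj' S).
  by move: hs'; rewrite inE.
have haS : a \in dominated adj S.
  move: hs; rewrite inE negbK => /subsetP; apply.
  exact: subsetP (closed_nbhd_remove_edge s) _ ha'.
have ha : a \in lost S by apply/setDP.
have [q hq eq_aq] := lostP ha.
apply/setP => w; rewrite inE !dominatedU !in_setU.
have [hw|hw] := boolP (w \in dominated adj S).
  have [_|hw'] := boolP (w \in dominated adj' S); first by rewrite !orbT.
  have hwl : w \in lost S by apply/setDP.
  by rewrite (card_le1_eqP (card_lost S) a w ha hwl) ha' orbT.
suff -> : w \in closed_nbhd adj' u by [].
have hwu : w \in closed_nbhd adj u.
  have: w \in dominated adj (u |: S) by rewrite hUu in_setT.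
  by rewrite dominatedU in_setU (negPf hw) orbF.
(* Otherwise [u] and [w] are the ends of the deleted edge, and one of them is the chosen vertex [q];
   but both are undominated in [G]. *)
apply: contraT => /(closed_nbhd_lost hwu); rewrite -eq_aq => e.
have: q \in [set u; w] by rewrite e !inE eqxx.
by rewrite !inE => /orP[] /eqP eq; move: hu hw; rewrite -eq (dominated_mem _ hq).
Qed.

Lemma dominator_value_remove_edge1 S :
  game_value adj false S <= 1 -> game_value adj' false S <= 2.
Proof.
have [hS _|hS] := eqVneq (dominated adj S) setT.
  by apply: leqW; apply: game_value_remove_edge_dominated.
case/(dominator_value_leP _ hS) => d _ /game_value_leq0 hd.
have [hd'|hd'] := boolP (d \in legal_moves adj' S).
  by apply: dominator_value_le hd' _; apply: game_value_remove_edge_dominated.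
(* Here [d] adds nothing in [G - e], so already without [d] at most one vertex is undominated
   there. *)
apply: leq_trans (game_value_le_card _ _ _) _.
by rewrite -(illegal_dominatedU hd') (leq_trans (card_undominated_remove_edge hd)).
Qed.

(* If Dominator's reply [d] in [G] is illegal in [G - e], he plays instead any
   vertex [u] that [d] leaves undominated: [d] adds nothing in [G - e], and
   [u], [d] together end the game in [G], so at most one vertex remains. *)
Lemma dominator_value_remove_edge2 S :
  game_value adj false S <= 2 -> game_value adj' false S <= 3.
Proof.
have [hS _|hS] := eqVneq (dominated adj S) setT.
  by apply: leqW; apply: leqW; apply: game_value_remove_edge_dominated.
case/(dominator_value_leP _ hS) => d _ h1.
have [hd'|hd'] := boolP (d \in legal_moves adj' S).
  exact: dominator_value_le hd' (staller_value_remove_edge h1).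
have eS := illegal_dominatedU hd'.
have [hd|] := eqVneq (dominated adj (d |: S)) setT.
  apply: leq_trans (game_value_le_card _ _ _) _.
  by rewrite -eS (leq_trans (card_undominated_remove_edge hd)).
rewrite -subTset => /subsetPn[u _ hu].
have hUu := staller_value_le1 h1 (undominated_legal hu).
have hu' : u \in legal_moves adj' S.
  apply: undominated_legal; rewrite -eS; apply: contra hu => /bigcupP[v hv hvu].
  by apply/bigcupP; exists v; rewrite // (subsetP (closed_nbhd_remove_edge v)).
apply: dominator_value_le hu' _; apply: leqW.
apply: leq_trans (game_value_le_card _ _ _) _.
have -> : dominated adj' (u |: S) = dominated adj' (u |: (d |: S)).
  by rewrite !(dominatedU _ u) eS.
exact: card_undominated_remove_edge.
Qed.

Lemma gamma_g'_remove_edge l : 0 < l < 4 -> gamma_g' adj <= l ->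
  gamma_g' adj' <= l.+1.
Proof.
(* The vertex [x] shows that the graph is nonempty. *)
have h0 : dominated adj set0 != setT.
  by apply/eqP => /setP/(_ x); rewrite /dominated big_set0 !inE.
case: l => // l /andP[_ hl] hG; apply: staller_value_le => s _.
(* Every vertex is a legal opening in [G], so the opening [s] of Staller in [G - e] can be copied in
   [G]. Dominator then faces a value of at most 0, 1 or 2 in [G]. *)
have {hG} := (staller_value_leP l h0).1 hG s; rewrite undominated_legal; last first.
  by rewrite /dominated big_set0 inE.
move=> /(_ isT); case: l hl => [|[|[|//]]] _.
- by move/game_value_leq0; apply: game_value_remove_edge_dominated.
- exact: dominator_value_remove_edge1.
- exact: dominator_value_remove_edge2.
Qed.

End EdgeRemoval.

Theorem mainTheorem16 (l : nat) (hl : 0 < l < 4) :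
  ~ exists (T : finType) (adj : rel T) (x y : T),
      [/\ simple_graph adj, adj x y, gamma_g' adj = l
        & gamma_g' (remove_edge adj x y) = l + 2].
Proof.
case=> T [adj [x [y [_ _ hG hG']]]].
have := @gamma_g'_remove_edge T adj x y l hl.
by rewrite hG hG' leqnn addn2 ltnn => /(_ isT).
Qed.
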